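(* There is an absolute constant $C>0$ such that for all $0<\epsilon<1$ and $0<\alpha<1/2$, we have $M_{eq}(\epsilon+\alpha)\le C\alpha^{-C}M(\epsilon)$.
   Context: For vertex subsets $X,Y$ of a graph, $e(X,Y)$ is the number of pairs $(x,y)\in X\times Y$ that are edges and $d(X,Y)=e(X,Y)/(|X||Y|)$; $\operatorname{irreg}(X,Y)=\max_{U\subseteq X,W\subseteq Y}|e(U,W)-|U||W|d(X,Y)|$, and for a vertex partition $\mathcal{P}$, $\operatorname{irreg}(\mathcal{P})=\sum_{X,Y\in\mathcal{P}}\operatorname{irreg}(X,Y)$. $M(\epsilon)$ is the smallest $M$ such that every graph $G=(V,E)$ has a vertex partition into at most $M$ parts with irregularity at most $\epsilon|V|^2$. $M_{eq}(\epsilon)$ is the smallest $M$ such that every graph $G=(V,E)$ has an equitable vertex partition (any two parts differ in size by at most one) into at most $M$ parts with irregularity at most $\epsilon|V|^2$. *)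

(* Defs.v *)
From HB Require Import structures.
From mathcomp Require Import all_boot all_order all_algebra.
From mathcomp Require Import all_classical all_reals all_analysis.

Set Implicit Arguments.
Unset Strict Implicit.
Unset Printing Implicit Defensive.

Import Order.TTheory GRing.Theory Num.Theory.
Local Open Scope ring_scope.

Section Irregularity.
Variables (R : realType) (T : finType) (g : rel T).
Implicit Types X Y U W : {set T}.

Definition edges X Y : nat :=
  #|[set p : T * T | [&& p.1 \in X, p.2 \in Y & g p.1 p.2]]%SET|.

(* Only meaningful for nonempty X and Y. *)
Definition density X Y : R := (edges X Y)%:R / (#|X|%:R * #|Y|%:R).

(* The index set contains (set0, set0) and all terms are nonnegative, so the
   default value 0 does not affect the maximum. *)
Definition irreg X Y : R :=
  \big[Num.max/0]_(UW : {set T} * {set T} | (UW.1 \subset X) && (UW.2 \subset Y))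
    `|(edges UW.1 UW.2)%:R - #|UW.1|%:R * #|UW.2|%:R * density X Y|.

(* Ordered pairs of parts, including X = Y. *)
Definition irreg_part (P : {set {set T}}) : R :=
  \sum_(X in P) \sum_(Y in P) irreg X Y.

End Irregularity.

Definition simple_graph (T : finType) (g : rel T) : Prop :=
  symmetric g /\ irreflexive g.

Definition equitable (T : finType) (P : {set {set T}}) : Prop :=
  forall X Y : {set T}, X \in P -> Y \in P -> (#|X| <= #|Y|.+1)%N.

(* [finset.partition P [set: T]] requires the parts to be nonempty. *)
Definition regular_bound (R : realType) (eps : R) (m : nat) : Prop :=
  forall (T : finType) (g : rel T), simple_graph g ->
  exists P : {set {set T}},
    [/\ finset.partition P [set: T]%SET, (#|P| <= m)%N
      & irreg_part R g P <= eps * #|T|%:R ^+ 2].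

Definition regular_bound_eq (R : realType) (eps : R) (m : nat) : Prop :=
  forall (T : finType) (g : rel T), simple_graph g ->
  exists P : {set {set T}},
    [/\ finset.partition P [set: T]%SET, equitable P, (#|P| <= m)%N
      & irreg_part R g P <= eps * #|T|%:R ^+ 2].

Local Open Scope classical_set_scope.
Local Open Scope ereal_scope.

(* The least natural number satisfying Q, or +oo if there is none. *)
Definition smallest (R : realType) (Q : nat -> Prop) : \bar R :=
  ereal_inf [set (m%:R)%:E | m in [set m : nat | Q m]].

Lemma smallestE (R : realType) (Q : nat -> Prop) (m : nat) :
  Q m -> (forall k, Q k -> (m <= k)%N) -> smallest R Q = (m%:R)%:E.
Proof.
move=> Qm min_m; apply/eqP; rewrite eq_le; apply/andP; split.
  by apply: ereal_inf_lbound; exists m.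
by apply: le_ereal_inf_tmp => _ [k Qk <-]; rewrite lee_fin ler_nat; exact: min_m.
Qed.

Definition M (R : realType) (eps : R) : \bar R := smallest R (regular_bound eps).

Definition M_eq (R : realType) (eps : R) : \bar R :=
  smallest R (regular_bound_eq eps).

(* Main.v *)
Require Import Defs.
From mathcomp Require Import all_boot all_order all_algebra all_fingroup.
From mathcomp Require Import all_classical all_reals all_analysis.
From mathcomp Require Import ring lra zify.

(* Let [Q] be a partition into at most [m] parts with small irregularity, and let
   [K] be of order [m / alpha]. If the graph has fewer than [K / alpha^2] vertices
   (up to constants), singletons will do. Otherwise cut the vertices into [K]
   pieces of [q] (or [q + 1]) vertices, [q] of order at least [alpha^-2], all but
   [m] of them inside a part of [Q], and then, for every [p < q], permute at random
   the [p]-th vertices of the pieces lying in the same part. On average this costs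
   only [alpha] in irregularity: if [Y'] is a random set of [q] vertices, one from
   each of [q] groups, then for a fixed [X] the cut norm of [A] on [X * Y'] is the
   maximum over [U] included in [X] (and over a sign) of
   [\sum_(y in Y') max 0 (+/- A(U, y))], and symmetrization followed by the
   contraction principle for [max 0] bounds its excess over the rescaled cut norm
   on [X * Y] by [2 #|X| sqrt q]. Using this first for columns, then for rows,
   shows that the cut norm passes to random pieces up to a relative [1 / sqrt q]. *)

Set Implicit Arguments.
Unset Strict Implicit.
Unset Printing Implicit Defensive.

Import Order.TTheory GRing.Theory Num.Theory.
Local Open Scope ring_scope.

(** * Symmetrization and contraction *)

Section Resample.
Variables (R : realType) (P O : finType).
Implicit Types (f : {ffun P -> O}) (p : P) (o : O).

Definition upd f p o : {ffun P -> O} := [ffun p' => if p' == p then o else f p'].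

Lemma updE f p o : upd f p o p = o.
Proof. by rewrite ffunE eqxx. Qed.

Lemma upd_neq f p p' o : p' != p -> upd f p o p' = f p'.
Proof. by rewrite ffunE => /negbTE->. Qed.

(** Exchanging [f p] with the fresh value [o] is an involution of the pairs [(f, o)], so resampling
    one coordinate preserves the uniform average. *)
Lemma sum_upd p (F : {ffun P -> O} -> R) :
  \sum_f \sum_o F (upd f p o) = (\sum_f F f) * #|O|%:R.
Proof.
pose swap (u : {ffun P -> O} * O) := (upd u.1 p u.2, u.1 p).
have swapK : involutive swap.
  move=> [f o]; rewrite /swap /= updE; congr pair.
  by apply/ffunP => p'; rewrite !ffunE; case: eqP => [->|].
rewrite pair_bigA /= (reindex_inj (inv_inj swapK)) /=.
rewrite (eq_bigr (fun u => F u.1)); last first.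
  by move=> u _; rewrite -/(swap u) -[upd _ _ _]/((swap (swap u)).1) swapK.
rewrite -(pair_bigA _ (fun f _ => F f)) /= mulr_suml.
by apply: eq_bigr => f _; rewrite sumr_const mulr_natr.
Qed.

(** Conditioning on all coordinates but [p]: only the averages over that one coordinate need
    comparing. *)
Lemma ler_sum_upd p (F1 F2 : {ffun P -> O} -> R) : (0 < #|O|)%N ->
  (forall f, \sum_o F1 (upd f p o) <= \sum_o F2 (upd f p o)) ->
  \sum_f F1 f <= \sum_f F2 f.
Proof.
move=> O_gt0 leF; rewrite -(ler_pM2r (x := #|O|%:R)) ?ltr0n // -!(sum_upd p).
exact: ler_sum.
Qed.

End Resample.

Section MaxValue.
Variables (R : realType) (I : finType) (i0 : I).
Implicit Types (c h a : I -> R).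

(** Through [arg max] the maximum is attained, with no default value that could interfere when [h]
    is negative. *)
Definition maxv h : R := h [arg max_(i > i0) h i]%O.

Lemma maxv_ge h i : h i <= maxv h.
Proof. by rewrite /maxv; case: arg_maxP => // j _ /(_ i isT). Qed.

Lemma maxv_attained h : exists i, maxv h = h i.
Proof. by exists [arg max_(i > i0) h i]%O. Qed.

Lemma maxv_le h (M : R) : (forall i, h i <= M) -> maxv h <= M.
Proof. by move=> hM; rewrite /maxv hM. Qed.

(** With [i] and [j] maximizing the two left terms, the left side is [c i + c j + (h i - h j)], at
    most [c i + c j + |a i - a j|]. According to the sign of [a i - a j], the right maxima are
    tested at [i], [j] or at [j], [i]. *)
Lemma maxv_contraction c h a : (forall i j, `|h i - h j| <= `|a i - a j|) ->
  maxv (fun i => c i + h i) + maxv (fun i => c i - h i) <=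
  maxv (fun i => c i + a i) + maxv (fun i => c i - a i).
Proof.
move=> lip.
have [i ->] := maxv_attained (fun i => c i + h i).
have [j ->] := maxv_attained (fun i => c i - h i).
have := maxv_ge (fun i => c i + a i) i; have := maxv_ge (fun i => c i - a i) i.
have := maxv_ge (fun i => c i + a i) j; have := maxv_ge (fun i => c i - a i) j.
have := lip i j; rewrite /= ler_norml => /andP[_].
by case: (ler0P (a i - a j)) => _ *; lra.
Qed.

End MaxValue.

Section Sampling.
Variables (R : realType) (P L I : finType) (i0 : I).

Definition sgb (b : bool) : R := if b then 1 else -1.

Lemma big_prod_bool (F : L -> bool -> R) :
  \sum_(o : L * bool) F o.1 o.2 = \sum_l (F l true + F l false).
Proof.
rewrite -(pair_bigA _ F) /=; apply: eq_bigr => l _.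
by rewrite big_bool.
Qed.

(* Replacing [h i l] by its mean plus a randomly signed term: the mean of [h i]
   is written as the average over an independent copy of [l]. *)
Lemma symmetrization (c : I -> R) (h a : I -> L -> R) : (0 < #|L|)%N ->
  (forall l i j, `|h i l - h j l| <= `|a i l - a j l|) ->
  \sum_(o : L * bool) maxv i0 (fun i => c i + h i o.1) <=
  \sum_(o : L * bool)
    maxv i0 (fun i => c i + (\sum_l h i l) / #|L|%:R + 2 * sgb o.2 * a i o.1).
Proof.
move=> L_gt0 lip; have N_gt0 : 0 < #|L|%:R :> R by rewrite ltr0n.
set m := fun i => (\sum_l h i l) / #|L|%:R.
pose Mp l := maxv i0 (fun i => c i + m i + 2 * h i l).
pose Mn l := maxv i0 (fun i => c i + m i - 2 * h i l).
rewrite (big_prod_bool (fun l _ => maxv i0 (fun i => c i + h i l))).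
rewrite (big_prod_bool (fun l b => maxv i0 (fun i => c i + m i + 2 * sgb b * a i l))).
(* For each fixed [l], contraction replaces [h] by [a] in the two maxima of opposite signs. *)
apply: (@le_trans _ _ (\sum_l (Mp l + Mn l))); last first.
  apply: ler_sum => l _; rewrite /Mp /Mn /sgb.
  have := @maxv_contraction _ _ i0 (fun i => c i + m i) (fun i => 2 * h i l)
    (fun i => 2 * a i l).
  have -> : (fun i => c i + m i + 2 * 1 * a i l) = (fun i => c i + m i + 2 * a i l).
    by apply/funext => i; rewrite mulr1.
  have -> : (fun i => c i + m i + 2 * -1 * a i l) = (fun i => c i + m i - 2 * a i l).
    by apply/funext => i; ring.
  apply=> i j; rewrite -!mulrBr !normrM; apply: ler_wpM2l => //.
(* At a maximizer [i], twice the value is [(c i + m i + 2 * h i l) + (c i - m i)], and [c i - m i]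
   is the mean over [k] of [c i + m i - 2 * h i k], hence at most the mean of [Mn]. *)
have step l : 2 * maxv i0 (fun i => c i + h i l) <= Mp l + (\sum_k Mn k) / #|L|%:R.
  have [i ->] := maxv_attained i0 (fun i => c i + h i l).
  have leMp : c i + m i + 2 * h i l <= Mp l by exact: (maxv_ge _ (fun i => _)).
  have : (\sum_k (c i + m i - 2 * h i k)) / #|L|%:R <= (\sum_k Mn k) / #|L|%:R.
    rewrite ler_pM2r ?invr_gt0 //; apply: ler_sum => k _.
    exact: (maxv_ge _ (fun i => c i + m i - 2 * h i k)).
  rewrite big_split /= sumr_const -[(c i + m i) *+ _]mulr_natr mulrDl mulfK ?gt_eqF //.
  rewrite sumrN -mulr_sumr mulNr -mulrA -/(m i) => ?; lra.
rewrite (eq_bigr (fun l => 2 * maxv i0 (fun i => c i + h i l))); last first.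
  by move=> l _; ring.
apply: le_trans (ler_sum _ (fun l _ => step l)) _.
by rewrite !big_split /= sumr_const -[X in _ + X]mulr_natr divfK ?gt_eqF.
Qed.

(** Induction on [s]: with the other coordinates frozen, [symmetrization] treats coordinate [p], and
    the new signed term is absorbed into [c]. Hence [c] may depend on [f], but not on the
    coordinates still in [s]. *)
Lemma sum_symmetrization (h a : I -> P -> L -> R) (s : seq P)
    (c : I -> {ffun P -> L * bool} -> R) : (0 < #|L|)%N -> uniq s ->
  (forall p l i j, `|h i p l - h j p l| <= `|a i p l - a j p l|) ->
  (forall i f p o, p \in s -> c i (upd f p o) = c i f) ->
  \sum_f maxv i0 (fun i => c i f + \sum_(p <- s) h i p (f p).1) <=
  \sum_f maxv i0 (fun i => c i f + \sum_(p <- s)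
     ((\sum_l h i p l) / #|L|%:R + 2 * sgb (f p).2 * a i p (f p).1)).
Proof.
move=> L_gt0 + lip; elim: s c => [|p s IHs] c.
  by move=> _ _; under eq_bigr do under eq_fun do rewrite big_nil;
     under [leRHS]eq_bigr do under eq_fun do rewrite big_nil.
move=> /= /andP[pNs s_uniq] cE.
have O_gt0 : (0 < #|{: L * bool}|)%N by rewrite card_prod card_bool muln_gt0 L_gt0.
pose k i (o : L * bool) := (\sum_l h i p l) / #|L|%:R + 2 * sgb o.2 * a i p o.1.
apply: (@le_trans _ _ (\sum_(f : {ffun P -> L * bool})
   maxv i0 (fun i => (c i f + k i (f p)) + \sum_(p <- s) h i p (f p).1))).
  apply: (ler_sum_upd (p := p)) => // f.
  have sumE i o : \sum_(p' <- s) h i p' (upd f p o p').1 =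
                  \sum_(p' <- s) h i p' (f p').1.
    rewrite !big_seq; apply: eq_bigr => p' p's; rewrite upd_neq //.
    by apply: contraNneq pNs => <-.
  have := @symmetrization (fun i => c i f + \sum_(p' <- s) h i p' (f p').1)
     (fun i => h i p) (fun i => a i p) L_gt0 (lip p).
  congr (_ <= _); apply: eq_bigr => o _; congr (maxv _ _); apply/funext => i.
    by rewrite big_cons cE ?mem_head // updE sumE; ring.
  by rewrite cE ?mem_head // updE sumE /k; ring.
apply: le_trans (IHs (fun i f => c i f + k i (f p)) s_uniq _) _.
  move=> i f p' o p's; rewrite cE ?in_cons ?p's ?orbT // upd_neq //.
  by apply: contraNneq pNs => ->.
rewrite le_eqVlt; apply/orP; left; apply/eqP; apply: eq_bigr => f _.
by congr (maxv _ _); apply/funext => i; rewrite big_cons -addrA.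
Qed.

(** Averaging over the sign at [p] cancels the cross term of the square, so each coordinate adds at
    most 1 to the second moment. *)
Lemma signed_sum_sqr (B : P -> L -> R) (s : seq P) : (0 < #|L|)%N -> uniq s ->
  (forall p l, `|B p l| <= 1) ->
  \sum_(f : {ffun P -> L * bool}) (\sum_(p <- s) sgb (f p).2 * B p (f p).1) ^+ 2
    <= #|{ffun P -> L * bool}|%:R * (size s)%:R.
Proof.
move=> L_gt0 + B1; elim: s => [|p s IHs] /=.
  by move=> _; rewrite mulr0 big1 // => f _; rewrite big_nil expr0n.
move=> /andP[pNs s_uniq].
have O_gt0 : (0 < #|{: L * bool}|)%N by rewrite card_prod card_bool muln_gt0 L_gt0.
apply: (@le_trans _ _ (\sum_(f : {ffun P -> L * bool})
    ((\sum_(p <- s) sgb (f p).2 * B p (f p).1) ^+ 2 + 1))); last first.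
  rewrite big_split /= sumr_const -[(size s).+1%:R]natr1 mulrDr mulr1.
  by rewrite lerD2r IHs.
apply: (ler_sum_upd (p := p)) => // f.
have sumE o : \sum_(p' <- s) sgb (upd f p o p').2 * B p' (upd f p o p').1 =
              \sum_(p' <- s) sgb (f p').2 * B p' (f p').1.
  rewrite !big_seq; apply: eq_bigr => p' p's; rewrite upd_neq //.
  by apply: contraNneq pNs => <-.
under eq_bigr do rewrite big_cons updE sumE.
under [leRHS]eq_bigr do rewrite sumE.
set S := \sum_(p' <- s) _.
rewrite (big_prod_bool (fun l b => (sgb b * B p l + S) ^+ 2)).
rewrite (big_prod_bool (fun _ _ => S ^+ 2 + 1)).
apply: ler_sum => l _; rewrite /sgb.
have := B1 p l; rewrite -(ler_sqr (x := `|_|)) ?nnegrE // real_normK ?num_real // expr1n => ?.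
lra.
Qed.

(** Follows from the second moment by [2 t |S| <= S^2 + t^2] with [t = sqrt |P|]. *)
Lemma signed_sum_abs (B : P -> L -> R) : (0 < #|L|)%N ->
  (forall p l, `|B p l| <= 1) ->
  \sum_(f : {ffun P -> L * bool}) `|\sum_p sgb (f p).2 * B p (f p).1|
    <= #|{ffun P -> L * bool}|%:R * Num.sqrt (#|P|%:R).
Proof.
move=> L_gt0 B1; have := signed_sum_sqr L_gt0 (index_enum_uniq P) B1.
set N : R := #|{ffun _ -> _}|%:R.
have -> : size (index_enum P) = #|P| by rewrite cardT enumT.
set S := fun f : {ffun P -> L * bool} => \sum_p sgb (f p).2 * B p (f p).1.
have [P0|P_gt0] := posnP #|P|.
  move=> _; rewrite P0 sqrtr0 mulr0 big1 // => f _.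
  by rewrite big1 ?normr0 // => p; move: (card0_eq P0 p); rewrite inE.
set t := Num.sqrt _; have t_gt0 : 0 < t by rewrite sqrtr_gt0 ltr0n.
have tt : #|P|%:R = t * t :> R by rewrite -expr2 sqr_sqrtr ?ler0n.
rewrite tt => leS.
suff : 2 * t * (\sum_f `|S f|) <= 2 * t * (N * t).
  by rewrite ler_pM2l // mulr_gt0.
rewrite mulr_sumr.
apply: (@le_trans _ _ (\sum_f (S f ^+ 2 + t * t))).
  apply: ler_sum => f _; have := sqr_ge0 (`|S f| - t).
  by rewrite sqrrB real_normK ?num_real // => ?; lra.
rewrite big_split /= sumr_const -[X in _ + X]mulr_natl -/N; lra.
Qed.

(** The index [i] ranges over tests and [w i] is the weight of a test. Once contraction has removed
    the 1-Lipschitz [phi], the signed part is linear in [w i]; exchanging the sums over [p] and [x]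
    bounds it by the [S x f], which do not involve [i]. So the number of tests does not matter. The
    unsigned part is the mean, controlled by [M0]. *)
Lemma sampling (X : finType) (D : {set X}) (w : I -> X -> R)
    (B : X -> P -> L -> R) (phi : R -> R) (Phi : {ffun P -> L * bool} -> R) (M0 : R) :
  (0 < #|L|)%N -> (forall i x, `|w i x| <= 1) -> (forall x p l, `|B x p l| <= 1) ->
  (forall s t, `|phi s - phi t| <= `|s - t|) ->
  (forall f, exists i, Phi f <= \sum_p phi (\sum_(x in D) w i x * B x p (f p).1)) ->
  (forall i, \sum_p \sum_l phi (\sum_(x in D) w i x * B x p l) <= M0) ->
  \sum_f Phi f <= #|{ffun P -> L * bool}|%:R *
     (M0 / #|L|%:R + 2 * #|D|%:R * Num.sqrt #|P|%:R).
Proof.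
move=> L_gt0 w1 B1 lip PhiE M0E; have N_gt0 : 0 < #|L|%:R :> R by rewrite ltr0n.
pose a i p l := \sum_(x in D) w i x * B x p l.
pose h i p l := phi (a i p l).
have := @sum_symmetrization h a (index_enum P) (fun _ _ => 0) L_gt0
  (index_enum_uniq P) (fun p l i j => lip _ _) (fun _ _ _ _ _ => erefl).
move=> H; apply: le_trans (le_trans _ H) _.
  apply: ler_sum => f _; have [i Pi] := PhiE f; apply: le_trans Pi _.
  have := maxv_ge i0 (fun i => 0 + \sum_p h i p (f p).1) i.
  by rewrite add0r.
pose S x (f : {ffun P -> L * bool}) : R := `|\sum_p sgb (f p).2 * B x p (f p).1|.
apply: (@le_trans _ _ (\sum_(f : {ffun P -> L * bool})
    (M0 / #|L|%:R + 2 * \sum_(x in D) S x f))).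
  apply: ler_sum => f _; apply: maxv_le => i; rewrite add0r big_split /=.
  apply: lerD.
    by rewrite -mulr_suml ler_pM2r ?invr_gt0 // M0E.
  under eq_bigr do rewrite -mulrA; rewrite -mulr_sumr ler_pM2l //.
  under [leLHS]eq_bigr do rewrite /a mulr_sumr.
  rewrite exchange_big; apply: ler_sum => x _; rewrite /S.
  under [leLHS]eq_bigr do rewrite mulrCA.
  rewrite -mulr_sumr; apply: le_trans (ler_norm _) _; rewrite normrM.
  by rewrite -[leRHS]mul1r ler_wpM2r.
rewrite big_split /= sumr_const -[X in X + _]mulr_natl -mulr_sumr exchange_big /=.
rewrite mulrDr lerD2l.
have : \sum_(x in D) \sum_f S x f <=
   \sum_(x in D) #|{ffun P -> L * bool}|%:R * Num.sqrt #|P|%:R.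
  by apply: ler_sum => x _; apply: signed_sum_abs => // p l.
rewrite sumr_const -[X in _ <= X]mulr_natl => ?; lra.
Qed.

End Sampling.

(** * The cut norm of a random transversal *)

Section CutNorm.
Variables (R : realType) (T : finType).
Implicit Types (A : T -> T -> R) (X Y U W : {set T}).

Definition msum A U W : R := \sum_(x in U) \sum_(y in W) A x y.

Definition cutn A X Y : R :=
  \big[Num.max/0]_(UW : {set T} * {set T} | (UW.1 \subset X) && (UW.2 \subset Y))
    `|msum A UW.1 UW.2|.

(* Besides the cut norm, the deviation [msum A X Y] of the density is recorded:
   together they bound the irregularity for the density of the pair itself. *)
Definition defect A X Y : R := cutn A X Y + `|msum A X Y|.

Lemma msum_tr A U W : msum (fun x y => A y x) U W = msum A W U.
Proof. exact: exchange_big. Qed.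

Lemma msum_setUr A U W1 W2 : [disjoint W1 & W2] ->
  msum A U (W1 :|: W2) = msum A U W1 + msum A U W2.
Proof.
by move=> dis; rewrite /msum -big_split; apply: eq_bigr => x _;
  rewrite -bigU //; apply: eq_bigl => z; rewrite inE.
Qed.

Lemma msum_le A X Y : (forall x y, `|A x y| <= 1) ->
  `|msum A X Y| <= #|X|%:R * #|Y|%:R.
Proof.
move=> A1; rewrite mulr_natl -sumr_const.
apply: le_trans (ler_norm_sum _ _ _) _; apply: ler_sum => x _.
rewrite -sumr_const; apply: le_trans (ler_norm_sum _ _ _) _.
exact: ler_sum.
Qed.

Lemma cutn_ge A X Y U W : U \subset X -> W \subset Y -> `|msum A U W| <= cutn A X Y.
Proof.
by move=> UX WY; apply: (le_bigmax_cond _ (fun UW => `|msum A UW.1 UW.2|) (j := (U, W)));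
  rewrite /= UX.
Qed.

Lemma cutn_le A X Y (M : R) : 0 <= M ->
  (forall U W, U \subset X -> W \subset Y -> `|msum A U W| <= M) -> cutn A X Y <= M.
Proof. by move=> M0 leM; apply: bigmax_le => // -[U W] /andP[]; exact: leM. Qed.

Lemma cutn_ge0 A X Y : 0 <= cutn A X Y.
Proof. by apply: le_trans (cutn_ge A (finset.sub0set X) (finset.sub0set Y)). Qed.

Lemma cutn_attained A X Y : exists U W,
  [/\ U \subset X, W \subset Y & cutn A X Y <= `|msum A U W|].
Proof.
have sub0 : ((finset.set0, finset.set0 : {set T}).1 \subset X) &&
  ((finset.set0 : {set T}, finset.set0).2 \subset Y) by rewrite !finset.sub0set.
have [] := @arg_maxP _ R _ (finset.set0, finset.set0)
  (fun UW => (UW.1 \subset X) && (UW.2 \subset Y))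
  (fun UW => `|msum A UW.1 UW.2|) sub0.
move=> [U W] /= /andP[UX WY] leUW; exists U, W; split=> //.
apply: cutn_le => // U' W' UX' WY'; apply: (leUW (U', W')).
by rewrite /= UX'.
Qed.

Lemma cutn_mono A X X' Y Y' : X \subset X' -> Y \subset Y' ->
  cutn A X Y <= cutn A X' Y'.
Proof.
move=> XX YY; apply: cutn_le (cutn_ge0 _ _ _) _ => U W UX WY.
by apply: cutn_ge; [exact: fintype.subset_trans XX | exact: fintype.subset_trans YY].
Qed.

Lemma cutn_tr_le A X Y : cutn (fun x y => A y x) X Y <= cutn A Y X.
Proof.
by apply: cutn_le (cutn_ge0 _ _ _) _ => U W UX WY; rewrite msum_tr; exact: cutn_ge.
Qed.

Lemma defect_tr A X Y : defect (fun x y => A y x) X Y = defect A Y X.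
Proof.
rewrite /defect msum_tr; congr (_ + _); apply/eqP; rewrite eq_le.
by rewrite cutn_tr_le (cutn_tr_le (fun x y => A y x)).
Qed.

Lemma defect_ge0 A X Y : 0 <= defect A X Y.
Proof. by rewrite addr_ge0 ?cutn_ge0. Qed.

(** The cut norm is monotone, and the total over [X * Y] changes by at most the number of removed
    entries. *)
Lemma defect_subr A X Y Y' : (forall x y, `|A x y| <= 1) -> Y \subset Y' ->
  defect A X Y <= defect A X Y' + #|X|%:R * #|Y' :\: Y|%:R.
Proof.
move=> A1 YY; rewrite /defect -addrA; apply: lerD; first exact: cutn_mono.
have -> : msum A X Y' = msum A X Y + msum A X (Y' :\: Y).
  rewrite -[in LHS](finset.setID Y' Y) (finset.setIidPr YY) msum_setUr //.
  by rewrite finset.disjoints_subset finset.setCD finset.subsetUr.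
have := msum_le X (Y' :\: Y) A1; set v := msum _ _ _; set u := msum _ _ _.
by move=> vle; have := ler_normB (u + v) v; rewrite addrK; lra.
Qed.

End CutNorm.

Section SampleColumns.
Variables (R : realType) (T P L : finType) (y : L -> P -> T).
Hypothesis y_inj : injective (fun u : L * P => y u.1 u.2).
Implicit Types (A : T -> T -> R) (f : {ffun P -> L * bool}).

(** For each [p], [f] carries a choice in the group of the [y l p] together with a sign, so that a
    single average serves both sampling and symmetrization. *)
Definition sampled f : {set T} := [set y (f p).1 p | p : P].
Definition grid : {set T} := [set y u.1 u.2 | u : L * P].

Lemma sum_sampled f (F : T -> R) :
  \sum_(z in sampled f) F z = \sum_p F (y (f p).1 p).
Proof. by rewrite big_imset //= => p p' _ _ /(@y_inj (_, p) (_, p')) []. Qed.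

Lemma sum_grid (F : T -> R) : \sum_(z in grid) F z = \sum_p \sum_l F (y l p).
Proof.
rewrite big_imset /=; last by move=> u v _ _; exact: y_inj.
by rewrite exchange_big pair_bigA.
Qed.

Lemma sgb_norm (t : R) : exists b, `|t| = sgb R b * t.
Proof.
by case: (ler0P t) => _; [exists false | exists true]; rewrite /sgb ?mulN1r ?mul1r.
Qed.

Lemma sgb_le (b : bool) (t : R) : sgb R b * t <= `|t|.
Proof. by rewrite /sgb; case: b; rewrite ?mulN1r ?mul1r ?ler_norm // -normrN ler_norm. Qed.

Lemma norm_sgb (b : bool) : `|sgb R b| = 1.
Proof. by case: b; rewrite /sgb ?normrN normr1. Qed.

Lemma msum_columns A U W : msum A U W = \sum_(z in W) \sum_(x in U) A x z.
Proof. exact: exchange_big. Qed.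

Lemma sample_cutn A (X : {set T}) : (0 < #|L|)%N -> (forall x z, `|A x z| <= 1) ->
  \sum_f cutn A X (sampled f) <= #|{ffun P -> L * bool}|%:R *
    (cutn A X grid / #|L|%:R + 2 * #|X|%:R * Num.sqrt #|P|%:R).
Proof.
move=> L_gt0 A1.
(* A test is a sign and a row set; its weight is the signed indicator of that set. *)
pose w (i : bool * {set T}) x : R := sgb R i.1 * (x \in i.2)%:R.
have colE i z : \sum_(x in X) w i x * A x z =
    sgb R i.1 * \sum_(x in X :&: i.2) A x z.
  rewrite mulr_sumr (finset.big_setID i.2) /= -[RHS]addr0; congr (_ + _).
    by apply: eq_bigr => x; rewrite inE => /andP[_ xi]; rewrite /w xi mulr1.
  by rewrite big1 // => x; rewrite inE => /andP[/negbTE xi _];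
    rewrite /w xi mulr0 mul0r.
apply: (@sampling R P L (bool * {set T})%type (true, finset.set0) T X w
  (fun x p l => A x (y l p)) (fun t => Num.max 0 t)) => //.
- move=> i x; rewrite /w normrM norm_sgb mul1r normr_nat.
  by case: (x \in i.2); rewrite ?ler01 ?lexx.
- move=> s t; rewrite /Num.max; case: ltP => s0; case: ltP => t0;
    rewrite ?subrr ?normr0 //; rewrite ler_norml;
    have := ler_norm (s - t); have := ler_norm (- (s - t)); rewrite normrN;
    by move=> *; apply/andP; split; lra.
(* The positive parts over all sampled columns dominate the signed sum over the columns of the
   optimal [W]. *)
- move=> f; have [U [W [UX WY leUW]]] := cutn_attained A X (sampled f).
  have [b bE] := sgb_norm (msum A U W); exists (b, U).
  apply: le_trans leUW _; rewrite bE msum_columns.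
  under [leRHS]eq_bigr do rewrite colE /=.
  rewrite (finset.setIidPr UX)
    -(sum_sampled f (fun z => Num.max 0 (sgb R b * \sum_(x in U) A x z))).
  rewrite mulr_sumr [leRHS](finset.big_setID W) /= (finset.setIidPr WY).
  apply: ler_wpDr; first by apply: sumr_ge0 => z _; rewrite le_max lexx.
  by apply: ler_sum => z _; rewrite le_max lexx orbT.
- move=> i; under eq_bigr do under eq_bigr do rewrite colE.
  set U := X :&: i.2.
  rewrite -(sum_grid (fun z => Num.max 0 (sgb R i.1 * \sum_(x in U) A x z))).
  (* Conversely, over the grid the positive parts add up to the signed sum over the columns with
     positive sum, hence to at most the cut norm. *)
  pose W := [set z in grid | 0 < sgb R i.1 * \sum_(x in U) A x z].
  apply: le_trans (_ : `|msum A U W| <= _); last first.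
    by apply: cutn_ge; rewrite ?finset.subsetIl //;
      apply/fintype.subsetP => z; rewrite inE => /andP[].
  apply: le_trans (sgb_le i.1 _); rewrite msum_columns mulr_sumr.
  rewrite (finset.big_setID W) /= [X in _ + X <= _]big1 ?addr0; last first.
    move=> z; rewrite !inE => /andP[+ zg]; rewrite zg /= -leNgt => le0.
    exact: max_l.
  have -> : grid :&: W = W.
    by apply/finset.setIidPr/fintype.subsetP => z; rewrite inE => /andP[].
  apply: ler_sum => z; rewrite inE => /andP[_ gt0].
  by rewrite max_r // ltW.
Qed.

(** Rows and columns are all kept, so only a sign remains to be tested and [phi] is the identity. *)
Lemma sample_msum A (X : {set T}) : (0 < #|L|)%N -> (forall x z, `|A x z| <= 1) ->
  \sum_f `|msum A X (sampled f)| <= #|{ffun P -> L * bool}|%:R *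
    (`|msum A X grid| / #|L|%:R + 2 * #|X|%:R * Num.sqrt #|P|%:R).
Proof.
move=> L_gt0 A1.
apply: (@sampling R P L bool true T X (fun b _ => sgb R b)
  (fun x p l => A x (y l p)) id) => //.
- by move=> b _; rewrite norm_sgb.
- move=> f; have [b ->] := sgb_norm (msum A X (sampled f)); exists b.
  rewrite msum_columns sum_sampled mulr_sumr.
  by apply: ler_sum => p _; rewrite mulr_sumr.
- move=> b; apply: le_trans (sgb_le b _); rewrite msum_columns sum_grid.
  rewrite mulr_sumr; apply: ler_sum => p _; rewrite mulr_sumr.
  by apply: ler_sum => l _; rewrite mulr_sumr.
Qed.

Lemma sample_defect A (X : {set T}) : (0 < #|L|)%N -> (forall x z, `|A x z| <= 1) ->
  \sum_f defect A X (sampled f) <= #|{ffun P -> L * bool}|%:R *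
    (defect A X grid / #|L|%:R + 4 * #|X|%:R * Num.sqrt #|P|%:R).
Proof.
move=> L_gt0 A1; rewrite big_split /=.
have := sample_cutn X L_gt0 A1; have := sample_msum X L_gt0 A1.
rewrite /defect; lra.
Qed.

End SampleColumns.

(** * Shuffling the pieces *)

Section RandomPieces.
Variables (R : realType) (T J P : finType) (C : eqType).
Variables (v : J -> P -> T) (c : J -> C).
Hypothesis v_inj : injective (fun u : J * P => v u.1 u.2).
Implicit Types (A : T -> T -> R) (pi : {ffun P -> {perm J}}) (S : {set J}).

Definition admissible pi := [forall p, forall j, c (pi p j) == c j].
Definition piece pi j : {set T} := [set v (pi p j) p | p : P].
Definition block (k : C) : {set T} := [set v u.1 u.2 | u : J * P & c u.1 == k].
Definition pieces pi S : {set T} := [set v (pi u.2 u.1) u.2 | u : J * P & u.1 \in S].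

(** Piece [j] receives, at each position [p], the vertex that piece [f p] had there. Being an
    involution that preserves admissibility when [f] stays in the class of [j], it leaves averages
    over [pi] unchanged. *)
Definition shuffle j (f : P -> J) pi : {ffun P -> {perm J}} :=
  [ffun p => (tperm j (f p) * pi p)%g].

Lemma shuffleK j f : involutive (shuffle j f).
Proof. by move=> pi; apply/ffunP => p; rewrite !ffunE mulgA tperm2 mul1g. Qed.

Lemma shuffle_adm j f pi : (forall p, c (f p) = c j) ->
  admissible (shuffle j f pi) = admissible pi.
Proof.
have adm_sh pi' : (forall p, c (f p) = c j) -> admissible pi' ->
    admissible (shuffle j f pi').
  move=> cf /forallP adm; apply/forallP => p; apply/forallP => l.
  rewrite ffunE permM (eqP (forallP (adm p) _)).
  by case: tpermP => [->|->|//]; rewrite cf.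
move=> cf; apply/idP/idP; last exact: adm_sh.
by move=> adm; rewrite -(shuffleK j f pi); apply: adm_sh.
Qed.

(* The average over [pi] is unchanged when the entry [pi p j] is exchanged with
   that of a random [l] in [S], independently for every [p]; given [pi], the
   [j]-th piece then becomes a random transversal. *)
Lemma resample A j S (X : {ffun P -> {perm J}} -> {set T}) :
  (forall x z, `|A x z| <= 1) ->
  j \in S -> {in S, forall l, c l = c j} ->
  (forall f pi, (forall p, f p \in S) -> X (shuffle j f pi) = X pi) ->
  \sum_(pi | admissible pi) defect A (X pi) (piece pi j) <=
  \sum_(pi | admissible pi) (defect A (X pi) (pieces pi S) / #|S|%:R
     + 4 * #|X pi|%:R * Num.sqrt #|P|%:R).
Proof.
move=> A1 jS cS XE; pose L := {l : J | l \in S}.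
have cardL : #|{: L}| = #|S| by rewrite card_sig; apply: eq_card => x; rewrite !inE.
have L_gt0 : (0 < #|{: L}|)%N by rewrite cardL; apply/card_gt0P; exists j.
pose y pi (l : L) p := v (pi p (val l)) p.
have y_inj pi : injective (fun u : L * P => y pi u.1 u.2).
  move=> [l p] [l' p'] /(@v_inj (_, p) (_, p')) [] + pp; rewrite /= -pp.
  by move=> /perm_inj/val_inj ->.
pose F : {ffun P -> L * bool} -> P -> J := fun f p => val (f p).1.
have gridE pi : grid (y pi) = pieces pi S.
  apply/setP => z; apply/imsetP/imsetP => [[[l p] _ ->]|[[l p]]].
    by exists (val l, p) => //; rewrite !inE (valP l).
  rewrite !inE ?andbT /= => lS ->; by exists (exist _ l lS, p).
have pieceE f pi : piece (shuffle j (F f) pi) j = sampled (y pi) f.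
  by apply: eq_imset => p; rewrite ffunE permM tpermL.
set N : R := #|{ffun P -> L * bool}|%:R.
have N_gt0 : 0 < N.
  rewrite ltr0n; apply/card_gt0P; exists [ffun=> (exist _ j jS, true)].
  by rewrite inE.
(* Average over [f] as well: for each [f], reindexing by the shuffle turns piece [j] into the
   transversal sampled by [f]. *)
rewrite -(ler_pM2l N_gt0) mulr_natl -sumr_const.
rewrite (eq_bigr (fun f => \sum_(pi | admissible pi)
   defect A (X pi) (sampled (y pi) f))); last first.
  move=> f _; rewrite (reindex_inj (inv_inj (shuffleK j (F f)))) /=.
  apply: eq_big => pi; last by move=> _; rewrite XE ?pieceE // => p; exact: valP.
  by rewrite shuffle_adm // => p; apply: cS; exact: valP.
rewrite exchange_big mulr_sumr; apply: ler_sum => pi _.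
by have := sample_defect (y_inj pi) (X pi) L_gt0 A1; rewrite gridE cardL.
Qed.

(** Each [pi p] permutes the class [k], so the union of its pieces is no longer random. *)
Lemma pieces_class pi k : admissible pi -> pieces pi [set l | c l == k] = block k.
Proof.
move=> /forallP adm; have cpi p l : c (pi p l) = c l by apply/eqP/(forallP (adm p)).
apply/setP => z; apply/imsetP/imsetP => -[[l p]]; rewrite !inE ?andbT /=.
  by move=> /eqP cl ->; exists (pi p l, p); rewrite ?inE ?cpi //= cl eqxx.
move=> /eqP cl ->; exists ((pi p)^-1%g l, p); last by rewrite /= permKV.
by rewrite !inE ?andbT /= -(cpi p) permKV cl.
Qed.

Lemma card_piece pi j : #|piece pi j| = #|P|.
Proof. by rewrite card_imset // => p p' /(@v_inj (_, p) (_, p')) []. Qed.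

(** This is [resample] for the transposed matrix, with [S] the whole class of [i], since [V] is
    fixed. *)
Lemma resample_row A i (V : {set T}) : (forall x z, `|A x z| <= 1) ->
  \sum_(pi | admissible pi) defect A (piece pi i) V <=
  \sum_(pi | admissible pi) (defect A (block (c i)) V / #|[set l | c l == c i]|%:R
     + 4 * #|V|%:R * Num.sqrt #|P|%:R).
Proof.
move=> A1; have := @resample (fun x z => A z x) i [set l | c l == c i] (fun=> V).
move=> /(_ (fun x z => A1 z x)); rewrite inE eqxx => /(_ isT) H.
under eq_bigr do rewrite -defect_tr.
apply: le_trans (H _ _) _ => //; first by move=> l; rewrite inE => /eqP.
by apply: ler_sum => pi adm; rewrite pieces_class // defect_tr.
Qed.

(** Leaving [i] out of [S] makes the exchange fix the row set. If [i] and [j] share a class, the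
    union over [S] then misses piece [i] of the block, which costs at most [|P|^2] entries. *)
Lemma resample_col A i j : (forall x z, `|A x z| <= 1) -> i != j ->
  \sum_(pi | admissible pi) defect A (piece pi i) (piece pi j) <=
  \sum_(pi | admissible pi)
    ((defect A (piece pi i) (block (c j)) + (c i == c j)%:R * #|P|%:R ^+ 2)
        / #|[set l | (c l == c j) && (l != i)]|%:R
     + 4 * #|P|%:R * Num.sqrt #|P|%:R).
Proof.
move=> A1 ij; set S := [set l | _].
apply: le_trans (@resample A j S (fun pi => piece pi i) A1 _ _ _) _.
- by rewrite inE eqxx eq_sym.
- by move=> l; rewrite inE => /andP[/eqP].
- move=> f pi fS; apply: eq_imset => p; rewrite ffunE permM.
  by have := fS p; rewrite inE => /andP[_ fi]; rewrite tpermD // eq_sym.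
apply: ler_sum => pi adm; rewrite card_piece lerD2r.
apply: ler_wpM2r; first by rewrite invr_ge0.
have sub : pieces pi S \subset block (c j).
  rewrite -(pieces_class _ adm); apply: imsetS; apply/fintype.subsetP => u.
  by rewrite !inE ?andbT /= => /andP[].
apply: le_trans (defect_subr _ A1 sub) _; rewrite lerD2l card_piece.
have sub' : block (c j) :\: pieces pi S \subset
    (if c i == c j then piece pi i else finset.set0).
  apply/fintype.subsetP => z; rewrite inE -(pieces_class _ adm) => /andP[zN].
  case/imsetP => -[l p]; rewrite !inE ?andbT /= => cl zE.
  have [li|li] := eqVneq l i.
    by rewrite -li cl; apply/imsetP; exists p => //; rewrite zE li.
  by case/negP: zN; apply/imsetP; exists (l, p); rewrite ?inE ?cl.
have := subset_leq_card sub'; rewrite -(ler_nat R).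
case: (c i == c j) => /=; rewrite ?cards0 ?card_piece => le1.
  by rewrite mul1r expr2; apply: ler_wpM2l.
by rewrite mul0r mulr_ge0_le0 // (le_trans le1).
Qed.

End RandomPieces.

Section ClassSums.
Variables (R : realType) (J C : finType) (c : J -> C) (Q : {set C}).

(** Each of the [n] indices of a class [Y] contributes [z Y / n]; a class without indices
    contributes 0. *)
Lemma class_sum (s : pred J) (z : C -> R) : (forall Y, 0 <= z Y) ->
  \sum_(j | (c j \in Q) && s j) z (c j) / #|[set l | (c l == c j) && s l]|%:R <=
  \sum_(Y in Q) z Y.
Proof.
move=> z0; rewrite (partition_big c (mem Q)) /=; last by move=> j /andP[].
apply: ler_sum => Y YQ; set n := #|[set l | (c l == Y) && s l]|.
have [n0|n_gt0] := posnP n.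
  rewrite big_pred0 // => j; apply/negP => /andP[/andP[_ sj] cj].
  by have := cards0_eq n0 => /setP /(_ j); rewrite !inE cj sj.
rewrite (eq_bigr (fun=> z Y / n%:R)); last by move=> j /andP[_ /eqP ->].
rewrite sumr_const -[_ *+ _]mulr_natr.
have -> : #|[pred j | (c j \in Q) && s j & c j == Y]| = n.
  apply: eq_card => j; rewrite !inE; case: eqP => [->|]; last by rewrite andbF.
  by rewrite YQ /= andbT.
by rewrite divfK // pnatr_eq0 -lt0n.
Qed.

End ClassSums.

Section GoodShuffle.
Variables (R : realType) (T J P C : finType).
Variables (v : J -> P -> T) (c : J -> C) (Q : {set C}) (A : T -> T -> R).
Hypothesis v_inj : injective (fun u : J * P => v u.1 u.2).
Hypothesis A1 : forall x z, `|A x z| <= 1.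

Local Notation K := (#|J|%:R : R).
Local Notation q := (#|P|%:R : R).

Lemma card_block Y : #|block v c Y| = (#|[set j | c j == Y]| * #|P|)%N.
Proof.
rewrite card_imset // -cardsT -cardsX; apply: eq_card => u.
by rewrite !inE andbT.
Qed.

Lemma sum_card_block :
  \sum_(Y in Q) #|block v c Y|%:R = #|[set j | c j \in Q]|%:R * q.
Proof.
under eq_bigr do rewrite card_block natrM.
rewrite -mulr_suml -natr_sum; congr (_%:R * _).
rewrite -sum1_card (partition_big c (mem Q)) /=; last by move=> j; rewrite inE.
apply: eq_bigr => Y YQ; rewrite -sum1_card; apply: eq_bigl => j.
by rewrite !inE; case: eqP => [->|]; rewrite ?andbF ?YQ.
Qed.

Lemma sum_card_block_le : \sum_(Y in Q) #|block v c Y|%:R <= K * q.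
Proof. by rewrite sum_card_block ler_wpM2r ?ler_nat ?max_card. Qed.

Lemma sum_le_const (F : J -> R) (B : R) (S : pred J) : 0 <= B ->
  (forall j, S j -> F j <= B) -> \sum_(j | S j) F j <= K * B.
Proof.
move=> B0 FB; apply: le_trans (ler_sum _ FB) _.
by rewrite sumr_const -[leLHS]mulr_natl ler_wpM2r ?ler_nat ?max_card.
Qed.

(** Some shuffle does at least as well as the average. Columns are sampled first, then rows, each
    for [4 K^2 q sqrt q]; the term [K q^2] pays for the missing piece in [resample_col]. *)
Lemma good_shuffle : exists2 pi : {ffun P -> {perm J}}, admissible c pi &
  \sum_(i | c i \in Q) \sum_(j | (c j \in Q) && (j != i))
     defect A (piece v pi i) (piece v pi j) <=
  \sum_(X in Q) \sum_(Y in Q) defect A (block v c X) (block v c Y)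
  + K * q ^+ 2 + 8 * K ^+ 2 * q * Num.sqrt q.
Proof.
set Bd := (_ + 8 * K ^+ 2 * q * Num.sqrt q).
pose D pi i j := defect A (piece v pi i) (piece v pi j).
pose E pi i Y := defect A (piece v pi i) (block v c Y).
set t := Num.sqrt q; have t0 : 0 <= t by exact: sqrtr_ge0.
have q0 : 0 <= q by []. have K0 : 0 <= K by [].
suff le_avg : \sum_(pi : {ffun P -> {perm J}} | admissible c pi)
      \sum_(i | c i \in Q) \sum_(j | (c j \in Q) && (j != i)) D pi i j
    <= \sum_(pi : {ffun P -> {perm J}} | admissible c pi) Bd.
  (* If every admissible shuffle exceeded the bound, so would the sum; the identity shuffle shows
     that this sum is not empty. *)
  apply: contrapT => noP; move: le_avg; apply/negP; rewrite -ltNge.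
  apply: ltr_sum.
    apply/hasP; exists [ffun=> 1%g]; first by rewrite mem_index_enum.
    by apply/forallP => p; apply/forallP => j; rewrite ffunE perm1.
  by move=> pi adm; rewrite ltNge; apply/negP => le; apply: noP; exists pi.
have le_col : \sum_(pi : {ffun P -> {perm J}} | admissible c pi)
      \sum_(i | c i \in Q) \sum_(j | (c j \in Q) && (j != i)) D pi i j
    <= \sum_(pi : {ffun P -> {perm J}} | admissible c pi)
      (\sum_(i | c i \in Q) \sum_(Y in Q) E pi i Y
       + (K * q ^+ 2 + K * (K * (4 * q * t)))).
  rewrite exchange_big /=; under [leLHS]eq_bigr do rewrite exchange_big /=.
  apply: (@le_trans _ _ (\sum_(i | c i \in Q) \sum_(j | (c j \in Q) && (j != i))
    \sum_(pi : {ffun P -> {perm J}} | admissible c pi)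
    ((E pi i (c j) + (c i == c j)%:R * q ^+ 2)
        / #|[set l | (c l == c j) && (l != i)]|%:R + 4 * q * t))).
    apply: ler_sum => i _; apply: ler_sum => j /andP[_ ji].
    by apply: resample_col; rewrite // eq_sym.
  under [leLHS]eq_bigr do rewrite exchange_big /=.
  rewrite exchange_big /=; apply: ler_sum => pi adm.
  apply: (@le_trans _ _ (\sum_(i | c i \in Q)
     (\sum_(Y in Q) E pi i Y + (q ^+ 2 + K * (4 * q * t))))).
    apply: ler_sum => i ciQ; rewrite big_split /= addrA; apply: lerD.
      (* The correction [q ^+ 2] occurs only for the class of [i], hence once per row. *)
      apply: le_trans (class_sum c Q (fun j => j != i)
        (z := fun Y => E pi i Y + (c i == Y)%:R * q ^+ 2) _) _.
        by move=> Y; rewrite addr_ge0 ?defect_ge0 // mulr_ge0 ?sqr_ge0.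
      rewrite big_split /= lerD2l (bigD1 (c i)) //= eqxx mul1r big1 ?addr0 //.
      by move=> Y /andP[_ /negbTE]; rewrite eq_sym => ->; rewrite mul0r.
    by apply: sum_le_const => //; rewrite !mulr_ge0.
  rewrite big_split /= lerD2l -mulrDr; apply: sum_le_const => //.
  by rewrite addr_ge0 ?sqr_ge0 ?mulr_ge0.
apply: le_trans le_col _; rewrite !big_split /=.
have le_row : \sum_(pi : {ffun P -> {perm J}} | admissible c pi)
      \sum_(i | c i \in Q) \sum_(Y in Q) E pi i Y <=
    \sum_(pi : {ffun P -> {perm J}} | admissible c pi)
     (\sum_(X in Q) \sum_(Y in Q) defect A (block v c X) (block v c Y)
       + K * (4 * t * (K * q))).
  rewrite exchange_big /=; under [leLHS]eq_bigr do rewrite exchange_big /=.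
  apply: (@le_trans _ _ (\sum_(i | c i \in Q) \sum_(Y in Q)
    \sum_(pi : {ffun P -> {perm J}} | admissible c pi)
     (defect A (block v c (c i)) (block v c Y) / #|[set l | c l == c i]|%:R
       + 4 * #|block v c Y|%:R * t))).
    by apply: ler_sum => i _; apply: ler_sum => Y _; exact: resample_row.
  under [leLHS]eq_bigr do rewrite exchange_big /=.
  rewrite exchange_big /=; apply: ler_sum => pi adm.
  under eq_bigr do rewrite big_split /=; rewrite big_split /=; apply: lerD.
    rewrite exchange_big [leRHS]exchange_big /=; apply: ler_sum => Y _.
    apply: le_trans _ (class_sum c Q xpredT
      (z := fun X => defect A (block v c X) (block v c Y)) (fun X => defect_ge0 _ _ _)).
    rewrite le_eqVlt; apply/orP; left; apply/eqP.
    apply: eq_big => [i|i _]; first by rewrite andbT.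
    by congr (_ / _%:R); apply: eq_card => l; rewrite !inE andbT.
  apply: sum_le_const; first by rewrite !mulr_ge0.
  move=> i _; rewrite -mulr_suml -mulr_sumr; have := sum_card_block_le.
  set S := \sum_(Y in Q) _; rewrite -subr_ge0 => /(mulr_ge0 t0); lra.
apply: le_trans (lerD le_row (lexx _)) _.
rewrite -!big_split /=; apply: ler_sum => pi _; rewrite /Bd -/t.
set S := \sum_(X in Q) _; by rewrite le_eqVlt; apply/orP; left; apply/eqP; ring.
Qed.

End GoodShuffle.

(** * Irregularity and equitable refinements *)

Section IrregularityBounds.
Variables (R : realType) (T : finType) (g : rel T).
Implicit Types (X Y U W : {set T}) (B : T -> T -> R).

Definition dev (d : R) (x y : T) : R := (g x y)%:R - d.

Lemma msum_dev d U W : msum (dev d) U W = (edges g U W)%:R - #|U|%:R * #|W|%:R * d.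
Proof.
rewrite /msum /dev; under eq_bigr do rewrite big_split /= sumr_const.
rewrite big_split /= sumr_const; congr (_ + _); last first.
  by rewrite -[LHS]mulr_natl -[(- d) *+ _]mulr_natl; ring.
rewrite pair_big_dep /= /edges -sum1_card natr_sum big_mkcond [RHS]big_mkcond /=.
by apply: eq_bigr => -[x y] _; rewrite inE /=;
  case: (x \in U); case: (y \in W); case: (g x y).
Qed.

Lemma edges_le X Y : (edges g X Y <= #|X| * #|Y|)%N.
Proof.
rewrite -cardsX; apply: subset_leq_card; apply/fintype.subsetP => u.
by rewrite !inE => /and3P[-> ->].
Qed.

Lemma density_itv X Y : 0 <= density R g X Y <= 1.
Proof.
rewrite /density -natrM; apply/andP; split; first by rewrite divr_ge0.
have [->|XY] := posnP (#|X| * #|Y|); first by rewrite invr0 mulr0.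
by rewrite ler_pdivrMr ?ltr0n // mul1r ler_nat edges_le.
Qed.

Lemma dev_le1 d x y : 0 <= d <= 1 -> `|dev d x y| <= 1.
Proof.
by move=> /andP[d0 d1]; rewrite /dev ler_norml; case: (g x y) => /=;
  rewrite ?mulr1n ?mulr0n; apply/andP; split; lra.
Qed.

Lemma irregE X Y : irreg R g X Y = cutn (dev (density R g X Y)) X Y.
Proof. by apply: eq_bigr => UW _; rewrite msum_dev. Qed.

Lemma irreg_le X Y : irreg R g X Y <= #|X|%:R * #|Y|%:R.
Proof.
rewrite irregE; apply: cutn_le => [|U W UX WY]; first by rewrite mulr_ge0.
apply: le_trans (msum_le _ _ _) _; first by move=> x y; exact/dev_le1/density_itv.
by apply: ler_pM; rewrite // ler_nat subset_leq_card.
Qed.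

(** Replacing the true density by [d] changes a term by [|U| |W|] times the difference of the
    densities, at most [|X| |Y|] times it, which is exactly the total deviation
    [|msum (dev d) X Y|]. *)
Lemma irreg_defect d X Y : irreg R g X Y <= defect (dev d) X Y.
Proof.
rewrite irregE; apply: cutn_le => [|U W UX WY]; first exact: defect_ge0.
rewrite msum_dev.
have -> : (edges g U W)%:R - #|U|%:R * #|W|%:R * density R g X Y =
    msum (dev d) U W - #|U|%:R * #|W|%:R * (density R g X Y - d).
  by rewrite msum_dev; ring.
apply: le_trans (ler_normB _ _) _; apply: lerD; first exact: cutn_ge.
have leUW : #|U|%:R * #|W|%:R <= #|X|%:R * #|Y|%:R :> R.
  by rewrite -!natrM ler_nat leq_mul ?subset_leq_card.
(* For empty [X] or [Y] the density is a quotient by 0, but then [|U| |W|] vanishes too. *)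
have [XY0|XY] := eqVneq (#|X|%:R * #|Y|%:R : R) 0.
  have -> : #|U|%:R * #|W|%:R = 0 :> R.
    by apply/eqP; rewrite eq_le mulr_ge0 // andbT -XY0.
  by rewrite mul0r normr0.
rewrite normrM ger0_norm ?mulr_ge0 //.
apply: (@le_trans _ _ (#|X|%:R * #|Y|%:R * `|density R g X Y - d|)).
  by rewrite ler_wpM2r.
rewrite -[X in X * _](@ger0_norm _ (#|X|%:R * #|Y|%:R)) ?mulr_ge0 // -normrM.
by rewrite mulrBr {1}/density [X in X - _]mulrC divfK // msum_dev.
Qed.

(** The discarded entries lie in [X' * Y'] outside [X * Y]: they fill [(U :\: X) * W] and
    [(U :&: X) * (W :\: Y)]. *)
Lemma msum_restrict B X X' Y Y' U W : (forall x y, `|B x y| <= 1) ->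
  X \subset X' -> Y \subset Y' -> U \subset X' -> W \subset Y' ->
  `|msum B U W - msum B (U :&: X) (W :&: Y)|
     <= #|X'|%:R * #|Y'|%:R - #|X|%:R * #|Y|%:R.
Proof.
move=> B1 XX YY UX WY.
have splitr V : msum B V W = msum B V (W :&: Y) + msum B V (W :\: Y).
  rewrite -msum_setUr ?finset.setID // finset.disjoints_subset finset.setCD.
  by apply: fintype.subset_trans (finset.subsetIr _ _) (finset.subsetUr _ _).
have -> : msum B U W = msum B (U :&: X) W + msum B (U :\: X) W.
  by rewrite /msum (finset.big_setID X).
rewrite [msum B (U :&: X) W]splitr.
have cD (V V' V'' : {set T}) : V \subset V' -> V'' \subset V' ->
    #|V'' :\: V|%:R <= #|V'|%:R - #|V|%:R :> R.
  move=> sV sV''; rewrite lerBrDl -natrD ler_nat.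
  rewrite -(finset.cardsID V V') (finset.setIidPr sV) leq_add2l.
  by apply: subset_leq_card; exact: finset.setSD.
have := msum_le (U :&: X) (W :\: Y) B1; have := msum_le (U :\: X) W B1.
set u := msum _ _ (W :\: Y); set z := msum _ (U :\: X) _; set w := msum _ _ _.
have := cD X X' U XX UX; have := cD Y Y' W YY WY.
have : #|U :&: X|%:R <= #|X|%:R :> R by rewrite ler_nat subset_leq_card ?finset.subsetIr.
have : #|W|%:R <= #|Y'|%:R :> R by rewrite ler_nat subset_leq_card.
have : 0 <= #|U :&: X|%:R :> R by []. have : 0 <= #|W|%:R :> R by [].
have : 0 <= #|U :\: X|%:R :> R by []. have : 0 <= #|W :\: Y|%:R :> R by [].
move: #|U :&: X|%:R #|W|%:R #|U :\: X|%:R #|W :\: Y|%:R => a1 a2 a3 a4.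
move=> p4 p3 p2 p1 l2 l1 l4 l3 lz lu.
have -> : w + u + z - w = u + z by ring.
apply: le_trans (ler_normD _ _) _.
have := ler_pM p1 p4 l1 l4; have := ler_pM p3 p2 l3 l2; nra.
Qed.

Lemma eq_msum B B' U W : {in U & W, forall x y, B x y = B' x y} ->
  msum B U W = msum B' U W.
Proof. by move=> BB; apply: eq_bigr => x xU; apply: eq_bigr => y yW; exact: BB. Qed.

(** Both the cut norm and the total move by at most the number of entries outside [X * Y], whence
    the factor 2. *)
Lemma defect_restrict B B' X X' Y Y' : (forall x y, `|B x y| <= 1) ->
  X \subset X' -> Y \subset Y' -> {in X & Y, forall x y, B x y = B' x y} ->
  defect B X' Y' <= defect B' X Y + 2 * (#|X'|%:R * #|Y'|%:R - #|X|%:R * #|Y|%:R).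
Proof.
move=> B1 XX YY BB; set D := _ - _.
have key U W : U \subset X' -> W \subset Y' ->
    `|msum B U W| <= `|msum B' (U :&: X) (W :&: Y)| + D.
  move=> UX WY; have := msum_restrict B1 XX YY UX WY.
  rewrite (@eq_msum B B' (U :&: X)); last first.
    by move=> x y; rewrite !inE => /andP[_ xX] /andP[_ yY]; exact: BB.
  set u := msum _ _ _; set w := msum _ _ _ => le1.
  by have := ler_normD (u - w) w; rewrite subrK; rewrite -/D in le1; lra.
have h1 : cutn B X' Y' <= cutn B' X Y + D.
  have [U [W [UX WY leUW]]] := cutn_attained B X' Y'.
  apply: le_trans leUW (le_trans (key _ _ UX WY) _); rewrite lerD2r.
  by apply: cutn_ge; exact: finset.subsetIr.
have := key X' Y' (fintype.subxx _) (fintype.subxx _).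
rewrite (finset.setIidPr XX) (finset.setIidPr YY) /defect; lra.
Qed.

Variable Q : {set {set T}}.
Hypothesis partQ : finset.partition Q [set: T].

(** One matrix for all pairs of parts, adjacency minus the step function of densities, so that a
    single shuffle can serve every pair at once. *)
Definition partdev x y : R := dev (density R g (finset.pblock Q x) (finset.pblock Q y)) x y.

Lemma partdev_le1 x y : `|partdev x y| <= 1.
Proof. exact/dev_le1/density_itv. Qed.

Lemma partdevE X Y x y : X \in Q -> Y \in Q -> x \in X -> y \in Y ->
  partdev x y = dev (density R g X Y) x y.
Proof.
move: partQ => /and3P[_ tiQ _] XQ YQ xX yY.
by rewrite /partdev (finset.def_pblock tiQ XQ xX) (finset.def_pblock tiQ YQ yY).
Qed.

(** The cut norm is at most that of the full parts, which is their irregularity. The total over full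
    parts is 0, so over [X * Y] it is at most the number of remaining entries. *)
Lemma defect_subpart X X' Y Y' : X' \in Q -> Y' \in Q ->
  X \subset X' -> Y \subset Y' ->
  defect partdev X Y <= irreg R g X' Y' + (#|X'|%:R * #|Y'|%:R - #|X|%:R * #|Y|%:R).
Proof.
move=> XQ YQ XX YY; set d := density R g X' Y'.
have eqB U W : U \subset X' -> W \subset Y' -> msum partdev U W = msum (dev d) U W.
  move=> /fintype.subsetP UX /fintype.subsetP WY; apply: eq_msum => x y xU yW.
  by apply: partdevE => //; [exact: UX | exact: WY].
apply: lerD.
  rewrite irregE; apply: cutn_le (cutn_ge0 _ _ _) _ => U W UX WY.
  have UX' := fintype.subset_trans UX XX; have WY' := fintype.subset_trans WY YY.
  by rewrite eqB //; exact: cutn_ge.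
have := @msum_restrict (dev d) X X' Y Y' X' Y'
  (fun x y => dev_le1 x y (density_itv _ _)) XX YY (fintype.subxx _) (fintype.subxx _).
rewrite (finset.setIidPr XX) (finset.setIidPr YY) -eqB // -eqB //.
have -> : msum partdev X' Y' = 0.
  rewrite eqB // msum_dev /d /density.
  have [XY0|XY] := eqVneq (#|X'|%:R * #|Y'|%:R : R) 0.
    rewrite XY0 mul0r subr0; apply/eqP; rewrite pnatr_eq0 -leqn0.
    by apply: leq_trans (edges_le _ _) _; rewrite leqn0 -(pnatr_eq0 R) natrM XY0.
  by rewrite mulrC divfK // subrr.
by rewrite sub0r normrN.
Qed.

End IrregularityBounds.

(** * Cutting the vertex set into runs of equal length *)

Section Layout.
Variables (T : finType) (Q : {set {set T}}) (K q r : nat).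
Hypothesis partQ : finset.partition Q [set: T].
Hypothesis card_T : #|T| = (K * q + r)%N.
Hypothesis K_gt0 : (0 < K)%N.
Hypothesis q_gt0 : (0 < q)%N.
Hypothesis r_le : (r <= K)%N.

(* List the vertices part by part and cut the list into [K] runs of length [q];
   a run that lies in no single part contains the end of the part it starts in,
   so there are at most [#|Q|] of them. *)
Lemma layout : exists (v : 'I_K -> 'I_q -> T) (ext : 'I_K -> {set T})
    (c : 'I_K -> {set T}),
  [/\ injective (fun u : 'I_K * 'I_q => v u.1 u.2),
     [/\ forall j, (#|ext j| <= 1)%N,
         forall i j, i != j -> [disjoint ext i & ext j],
         forall j p i, v j p \notin ext i
       & forall x, (exists j p, x = v j p) \/ (exists j, x \in ext j)],
     forall j p, c j \in Q -> v j p \in c j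
   & (#|[set j | c j \notin Q]| <= #|Q|)%N].
Proof.
have [x0 _] : exists x : T, x \in T.
  by apply/card_gt0P; rewrite card_T addn_gt0 muln_gt0 K_gt0 q_gt0.
(* Sorting by the rank of the part makes each part an interval of [s]. *)
pose rank x : nat := enum_rank (finset.pblock Q x).
pose le x y := (rank x <= rank y)%N.
have letot : total le by move=> x y; exact: leq_total.
have letr : transitive le by move=> y x z; exact: leq_trans.
pose s := sort le (enum T).
have size_s : size s = (K * q + r)%N by rewrite size_sort -cardE.
have uniq_s : uniq s by rewrite sort_uniq enum_uniq.
have mem_s x : x \in s by rewrite mem_sort mem_enum.
have sorted_s : sorted le s by exact: sort_sorted.
have rank_mono a b : (a <= b)%N -> (b < size s)%N ->
    (rank (nth x0 s a) <= rank (nth x0 s b))%N.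
  move=> ab bs; apply: (sorted_leq_nth letr (fun x => leqnn _) x0 sorted_s);
    rewrite ?inE //; exact: leq_ltn_trans bs.
have idx_lt (j : 'I_K) (p : 'I_q) : (j * q + p < K * q)%N.
  by have := ltn_ord j; have := ltn_ord p; nia.
have idx_lts (j : 'I_K) (p : 'I_q) : (j * q + p < size s)%N.
  by rewrite size_s ltn_addr.
pose v (j : 'I_K) (p : 'I_q) := nth x0 s (j * q + p).
(* The last [r <= K] vertices of the list are handed out one by one to the first [r] pieces. *)
pose ext (j : 'I_K) : {set T} := if (j < r)%N then [set nth x0 s (K * q + j)] else finset.set0.
(* The default [set0] is not in [Q], so [c j \notin Q] says exactly that run [j] lies in no single
   part. *)
pose c (j : 'I_K) : {set T} :=
  odflt finset.set0 [pick X in Q | [forall p, v j p \in X]].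
have [/eqP covQ tiQ Q0] := and3P partQ.
have inQ x : finset.pblock Q x \in Q by rewrite pblock_mem // covQ inE.
have in_pblock x : x \in finset.pblock Q x by rewrite mem_pblock covQ inE.
have extP j x : x \in ext j -> (j < r)%N /\ x = nth x0 s (K * q + j).
  by rewrite /ext; case: ifP => _; rewrite inE // => /eqP.
have badP j : c j \notin Q -> forall X, X \in Q -> exists p, v j p \notin X.
  rewrite /c; case: pickP => [X /andP[XQ _]|noX _ X XQ]; first by rewrite XQ.
  by move: (noX X); rewrite XQ /= => /negbT; rewrite negb_forall => /existsP.
exists v, ext, c; split.
- move=> [j p] [j' p'] /= /eqP; rewrite nth_uniq // => /eqP eqjp.
  have [Hp Hp'] := (ltn_ord p, ltn_ord p').
  have ej : (j : nat) = j' by nia.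
  have ep : (p : nat) = p' by nia.
  by congr pair; exact: val_inj.
- split.
  + by move=> j; rewrite /ext; case: ifP; rewrite ?cards1 ?cards0.
  + move=> i j ij; rewrite -setI_eq0; apply/eqP/setP => x; rewrite !inE.
    apply/negP => /andP[/extP[ir ->] /extP[jr /eqP]].
    rewrite nth_uniq ?size_s ?ltn_add2l // eqn_add2l => /eqP /val_inj ij'.
    by rewrite ij' eqxx in ij.
  + move=> j p i; apply/negP => /extP[ir /eqP].
    rewrite nth_uniq ?size_s ?ltn_add2l ?ltn_addr // => /eqP E.
    by have := idx_lt j p; rewrite E ltnNge leq_addr.
  + move=> x; have := mem_s x; rewrite -index_mem size_s => ltx.
    have xE := nth_index x0 (mem_s x).
    have [ltKq|leKq] := ltnP (index x s) (K * q); [left | right].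
      have jK : (index x s %/ q < K)%N by rewrite ltn_divLR.
      have pq : (index x s %% q < q)%N by rewrite ltn_mod.
      by exists (Ordinal jK), (Ordinal pq); rewrite /v /= -divn_eq xE.
    have jr : (index x s - K * q < r)%N by rewrite ltn_subLR.
    exists (Ordinal (leq_trans jr r_le)).
    by rewrite /ext /= jr subnKC // xE inE.
- move=> j p; rewrite /c; case: pickP => [X /andP[_ /forallP]|_] //=.
  by rewrite (negbTE Q0).
- pose f (j : 'I_K) := finset.pblock Q (nth x0 s (j * q)).
  have f_inj : {in [set j | c j \notin Q] &, injective f}.
    (* If runs [i < j] start in the same part, the ranks along run [i] are squeezed between two
       equal ranks, so run [i] lies inside that part. *)
    have wlt (i j : 'I_K) : c i \notin Q -> (i < j)%N -> f i <> f j.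
      move=> badi ij fij; have [p] := badP i badi (f i) (inQ _).
      case/negP; suff -> : f i = finset.pblock Q (v i p) by exact: in_pblock.
      apply: enum_rank_inj; apply/val_inj/eqP; rewrite eqn_leq.
      rewrite (rank_mono (i * q)%N) ?leq_addr //=.
      rewrite -[X in (_ <= X)%N]/(rank (nth x0 s (i * q))) /rank -/(f i) fij.
      apply: rank_mono; first by have := ltn_ord p; nia.
      by rewrite size_s; have := ltn_ord j; nia.
    move=> i j; rewrite !inE => badi badj fij; apply: val_inj.
    by case: (ltngtP i j) => // ij; [case: (wlt i j) | case: (wlt j i)].
  rewrite -(card_in_imset f_inj); apply: subset_leq_card.
  by apply/fintype.subsetP => X /imsetP[j _ ->]; exact: inQ.
Qed.

End Layout.

(** * The equitable partition and its irregularity *)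

Section Refinement.
Variables (R : realType) (T : finType) (g : rel T) (Q : {set {set T}}) (K q r : nat).
Hypothesis partQ : finset.partition Q [set: T].
Hypothesis card_T : #|T| = (K * q + r)%N.
Hypothesis K_gt0 : (0 < K)%N.
Hypothesis q_gt0 : (0 < q)%N.
Hypothesis r_le : (r <= K)%N.

Lemma sum_bool (J : finType) (b : pred J) : \sum_j (b j)%:R = #|[set j | b j]|%:R :> R.
Proof.
rewrite -natr_sum -sum1_card [in RHS]big_mkcond /=; congr _%:R.
by apply: eq_bigr => j _; rewrite inE; case: (b j).
Qed.

(** By [defect_subpart] the loss is [n^2 - u^2], with [u] the number of vertices in blocks. The
    other [w = n - u] vertices are leftovers or in bad runs, so [w <= K + |Q| q], and
    [n^2 - u^2 <= 2 n w]. *)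
Lemma sum_defect_block (v : 'I_K -> 'I_q -> T) (c : 'I_K -> {set T}) :
  injective (fun u : 'I_K * 'I_q => v u.1 u.2) ->
  (forall j p, c j \in Q -> v j p \in c j) ->
  (#|[set j | c j \notin Q]| <= #|Q|)%N ->
  \sum_(X in Q) \sum_(Y in Q) defect (partdev R g Q) (block v c X) (block v c Y) <=
  irreg_part R g Q + 2 * #|T|%:R * (K%:R + #|Q|%:R * q%:R).
Proof.
move=> v_inj vc bad_le.
have sub X : X \in Q -> block v c X \subset X.
  move=> XQ; apply/fintype.subsetP => x /imsetP[[j p]].
  by rewrite !inE ?andbT /= => /eqP cj ->; rewrite -cj vc // cj.
have le1 : \sum_(X in Q) \sum_(Y in Q) defect (partdev R g Q) (block v c X) (block v c Y)
  <= \sum_(X in Q) \sum_(Y in Q) (irreg R g X Y +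
      (#|X|%:R * #|Y|%:R - #|block v c X|%:R * #|block v c Y|%:R)).
  apply: ler_sum => X XQ; apply: ler_sum => Y YQ.
  by apply: (@defect_subpart R T g Q partQ) => //; exact: sub.
apply: le_trans le1 _; under eq_bigr do rewrite big_split /=.
rewrite big_split /= lerD2l.
under eq_bigr do rewrite big_split /= -mulr_sumr sumrN -mulr_sumr.
rewrite big_split /= -mulr_suml sumrN -mulr_suml.
rewrite -natr_sum -(finset.card_partition partQ) cardsT (sum_card_block _ _ Q v_inj) card_ord.
set b := #|[set j | c j \notin Q]| in bad_le.
have -> : #|[set j | c j \in Q]| = (K - b)%N.
  rewrite -[K in RHS]card_ord -(finset.cardsC [set j | c j \in Q]).
  have -> : ~: [set j | c j \in Q] = [set j | c j \notin Q] by apply/setP => j; rewrite !inE.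
  by rewrite addnK.
have bK : (b <= K)%N by rewrite (leq_trans (max_card _)) // card_ord.
have nE : #|T|%:R = (K - b)%:R * q%:R + (b%:R * q%:R + r%:R) :> R.
  by rewrite -!natrM -!natrD card_T; congr _%:R; nia.
have h1 : b%:R * q%:R + r%:R <= K%:R + #|Q|%:R * q%:R :> R.
  by rewrite -!natrM -!natrD ler_nat; nia.
have h2 : 0 <= (K - b)%:R * q%:R :> R by rewrite mulr_ge0.
have h3 : 0 <= b%:R * q%:R + r%:R :> R by rewrite addr_ge0 ?mulr_ge0.
move: nE h1 h2 h3; set u := _ * q%:R; set w := _ + r%:R; set z := _ + _ * _ => -> uz u0 w0.
have := ler_wpM2l (addr_ge0 u0 w0) uz; have := mulr_ge0 w0 w0; lra.
Qed.

(** The parts are the shuffled pieces with at most one leftover vertex each. Distinct pieces with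
    classes in [Q] are handled by [good_shuffle], all other pairs by the trivial bound. *)
Lemma equitable_refinement : exists P : {set {set T}},
  [/\ finset.partition P [set: T], equitable P, (#|P| <= K)%N
    & irreg_part R g P <= irreg_part R g Q
      + (2 * #|T|%:R * (K%:R + #|Q|%:R * q%:R) + K%:R * q%:R ^+ 2
         + 8 * K%:R ^+ 2 * q%:R * Num.sqrt q%:R + 6 * q%:R * K%:R ^+ 2
         + 4 * q%:R ^+ 2 * (K%:R + 2 * #|Q|%:R * K%:R))].
Proof.
have [v [ext [c [v_inj [ext1 ext_dis v_ext cover_T] vc bad_le]]]] :=
  layout partQ card_T K_gt0 q_gt0 r_le.
have [pi adm le_pi] := good_shuffle c Q v_inj (@partdev_le1 R T g Q).
have cpi p j : c (pi p j) = c j by apply/eqP; move/forallP: adm => /(_ p)/forallP.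
pose X j := piece v pi j; pose Z j := X j :|: ext j.
have XP j x : x \in X j -> exists p, x = v (pi p j) p.
  by case/imsetP => p _ ->; exists p.
have disXZ j : [disjoint X j & ext j].
  rewrite -setI_eq0; apply/eqP/setP => x; rewrite !inE; apply/negP => /andP[].
  by move=> /XP[p ->]; apply/negP; exact: v_ext.
have cardX j : #|X j| = q by rewrite card_piece // card_ord.
have cardZ j : #|Z j| = (q + #|ext j|)%N.
  by rewrite cardsU (eqP (_ : X j :&: ext j == finset.set0)) ?cards0 ?subn0 ?cardX // setI_eq0.
have ZP j x : x \in Z j -> (exists p, x = v (pi p j) p) \/ x \in ext j.
  by rewrite inE => /orP[/XP|]; [left | right].
have disZ i j : i != j -> [disjoint Z i & Z j].
  move=> ij; rewrite -setI_eq0; apply/eqP/setP => x; rewrite [RHS]inE.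
  apply/negP; rewrite finset.in_setI => /andP[/ZP[[p ->]|xi] /ZP[[p' xj]|xj]].
  - move: (@v_inj (_, p) (_, p') xj) => [] + pp; rewrite -pp => /perm_inj ij'.
    by rewrite ij' eqxx in ij.
  - by have := v_ext (pi p i) p j; rewrite xj.
  - by have := v_ext (pi p' j) p' i; rewrite -xj xi.
  - by have := ext_dis _ _ ij; rewrite -setI_eq0 => /eqP/setP/(_ x); rewrite !inE xi xj.
have Z0 : finset.set0 \notin [set Z j | j : 'I_K].
  apply/imsetP => -[j _ /esym Z0]; have := cardZ j; rewrite Z0 cards0; lia.
have [tiZ Z_inj] := trivIimset (fun i j _ _ ji => disZ i j (contra_neq esym ji)) Z0.
have partZ : finset.partition [set Z j | j : 'I_K] [set: T].
  apply/and3P; split=> //; apply/eqP/setP => x; rewrite finset.in_setT.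
  apply/bigcupP; have [[j [p ->]]|[j xj]] := cover_T x.
    exists (Z ((pi p)^-1%g j)); first exact: imset_f.
    by rewrite inE; apply/orP; left; apply/imsetP; exists p; rewrite ?permKV.
  by exists (Z j); [exact: imset_f | rewrite inE xj orbT].
exists [set Z j | j : 'I_K]; split=> //.
- move=> _ _ /imsetP[i _ ->] /imsetP[j _ ->]; rewrite !cardZ.
  by have := ext1 i; lia.
- by rewrite (leq_trans (leq_imset_card _ _)) // card_ord.
(* Adding leftovers to a good pair costs [2 ((q + 1)^2 - q^2) = 4 q + 2 <= 6 q]; any other pair has
   at most [(q + 1)^2 <= 4 q^2] entries. *)
have le_pair i j : irreg R g (Z i) (Z j) <=
    ((c i \in Q) && ((c j \in Q) && (j != i)))%:R * defect (partdev R g Q) (X i) (X j)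
    + 6 * q%:R + 4 * q%:R ^+ 2 * ((i == j)%:R + (c i \notin Q)%:R + (c j \notin Q)%:R).
  have q1 : 1 <= q%:R :> R by rewrite ler1n.
  have Zle k : #|Z k|%:R <= q%:R + 1 :> R by rewrite cardZ natrD lerD2l lern1.
  have ZZ : #|Z i|%:R * #|Z j|%:R <= (q%:R + 1) * (q%:R + 1) :> R by exact: ler_pM.
  case: (boolP (_ && _)) => [/and3P[ciQ cjQ ji]|].
    rewrite ciQ cjQ [i == j]eq_sym (negbTE ji) /= !addr0 mulr0 addr0 mul1r.
    have subX k : c k \in Q -> X k \subset c k.
      by move=> ck; apply/fintype.subsetP => x /XP[p ->]; rewrite -(cpi p) vc ?cpi.
    (* The density of the surrounding parts of [Q] serves as reference, because [partdev] uses it on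
       this pair. *)
    apply: le_trans (@irreg_defect R T g (density R g (c i) (c j)) _ _) _.
    apply: le_trans (defect_restrict (B' := partdev R g Q)
      (X := X i) (Y := X j) _ _ _ _) _.
    - by move=> x y; exact/dev_le1/density_itv.
    - exact: finset.subsetUl.
    - exact: finset.subsetUl.
    - move=> x y xi yj; apply/esym/(@partdevE R T g Q partQ) => //.
        exact: (fintype.subsetP (subX i ciQ)).
      exact: (fintype.subsetP (subX j cjQ)).
    rewrite lerD2l !cardX; lra.
  move=> Nij; rewrite mul0r add0r.
  have : 1 <= (i == j)%:R + (c i \notin Q)%:R + (c j \notin Q)%:R :> R.
    move: Nij; rewrite [j == i]eq_sym -!natrD ler1n.
    by case: (c i \in Q); case: (c j \in Q); case: (i == j).
  move=> /(ler_wpM2l (_ : 0 <= 4 * q%:R ^+ 2)) => /(_ _)/[!mulr1] => H.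
  apply: le_trans (@irreg_le R T g _ _) (le_trans ZZ _).
  have := H (mulr_ge0 (ler0n _ _) (sqr_ge0 _)); nra.
rewrite /irreg_part big_imset /=; last by move=> i j _ _; exact: (Z_inj i j isT isT).
apply: (@le_trans _ _ (\sum_i \sum_j
  (((c i \in Q) && ((c j \in Q) && (j != i)))%:R * defect (partdev R g Q) (X i) (X j)
    + 6 * q%:R + 4 * q%:R ^+ 2 * ((i == j)%:R + (c i \notin Q)%:R + (c j \notin Q)%:R)))).
  apply: ler_sum => i _; rewrite big_imset /=; last by move=> j k _ _; exact: (Z_inj j k isT isT).
  by apply: ler_sum => j _; exact: le_pair.
have -> : \sum_(i < K) \sum_(j < K)
  (((c i \in Q) && ((c j \in Q) && (j != i)))%:R * defect (partdev R g Q) (X i) (X j)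
    + 6 * q%:R + 4 * q%:R ^+ 2 * ((i == j)%:R + (c i \notin Q)%:R + (c j \notin Q)%:R))
  = \sum_(i | c i \in Q) \sum_(j | (c j \in Q) && (j != i))
      defect (partdev R g Q) (X i) (X j) + 6 * q%:R * K%:R ^+ 2
    + 4 * q%:R ^+ 2 * (K%:R + 2 * #|[set j | c j \notin Q]|%:R * K%:R).
  have e1 : \sum_(i < K) \sum_(j < K) (i == j)%:R = K%:R :> R.
    rewrite -[in RHS](card_ord K) -sum1_card natr_sum; apply: eq_bigr => i _.
    by rewrite (bigD1 i) //= eqxx big1 ?addr0 // => j /negbTE; rewrite eq_sym => ->.
  have cK (x : R) : \sum_(i < K) x = K%:R * x by rewrite sumr_const card_ord mulr_natl.
  rewrite (eq_bigr (fun i : 'I_K =>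
    \sum_(j < K) ((c i \in Q) && ((c j \in Q) && (j != i)))%:R
        * defect (partdev R g Q) (X i) (X j) + K%:R * (6 * q%:R)
    + 4 * q%:R ^+ 2 * (\sum_(j < K) (i == j)%:R + K%:R * (c i \notin Q)%:R
        + #|[set j | c j \notin Q]|%:R))); last first.
    move=> i _; rewrite !big_split /= cK -[X in _ + X = _]mulr_sumr.
    by rewrite !big_split /= cK !sum_bool.
  rewrite !big_split /= cK -[X in _ + X = _]mulr_sumr.
  rewrite !big_split /= !cK -mulr_sumr e1 sum_bool.
  congr (_ + _ + _); [|by ring|by ring].
  rewrite [RHS]big_mkcond /=; apply: eq_bigr => i _; case: (c i \in Q) => /=; last first.
    by rewrite big1 // => j _; rewrite mul0r.
  by rewrite [RHS]big_mkcond /=; apply: eq_bigr => j _; case: ifP; rewrite ?mul0r ?mul1r.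
have := sum_defect_block v_inj vc bad_le; move: le_pi; rewrite !card_ord.
set S1 := \sum_(i | _) _; set S2 := \sum_(i in _) _.
have : #|[set j | c j \notin Q]|%:R <= #|Q|%:R :> R by rewrite ler_nat.
move/(ler_wpM2l (_ : 0 <= 8 * q%:R ^+ 2 * K%:R)) => H.
have := H (mulr_ge0 (mulr_ge0 (ler0n _ _) (sqr_ge0 _)) (ler0n _ _)).
by rewrite /X; move: S1 S2 => S1 S2; rewrite /irreg_part; set S3 := \sum_(_ in Q) _; lra.
Qed.

End Refinement.

(** * Small graphs, choice of parameters and conclusion *)

Lemma singletons_regular (R : realType) (T : finType) (g : rel T) :
  exists P : {set {set T}}, [/\ finset.partition P [set: T], equitable P,
    (#|P| <= #|T|)%N & irreg_part R g P = 0].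
Proof.
exists [set [set x] | x : T]; split.
- have Z0 : finset.set0 \notin [set [set x] | x : T].
    by apply/imsetP => -[x _ /setP/(_ x)]; rewrite !inE eqxx.
  have [] := @trivIimset _ _ (mem T) (fun x : T => [set x]) _ Z0.
    move=> x y _ _ yx; rewrite disjoints1 inE eq_sym.
    by apply: contra_neqN yx => /eqP.
  move=> tiZ _; apply/and3P; split=> //; apply/eqP/setP => x; rewrite finset.in_setT.
  by apply/bigcupP; exists [set x]; rewrite ?inE //; apply/imsetP; exists x.
- by move=> _ _ /imsetP[x _ ->] /imsetP[y _ ->]; rewrite !cards1.
- exact: leq_imset_card.
rewrite /irreg_part big1 // => _ /imsetP[x _ ->]; rewrite big1 // => _ /imsetP[y _ ->].
(* Between singletons the density is the entry itself, so every deviation is 0. *)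
rewrite irregE; apply/eqP; rewrite eq_le cutn_ge0 andbT.
apply: cutn_le => // U W; rewrite !finset.subset1.
case/orP => /eqP ->; last by rewrite /msum big_set0 normr0.
case/orP => /eqP ->; last by rewrite /msum big1 ?normr0 // => z _; rewrite big_set0.
by rewrite msum_dev /density !cards1 !mul1r invr1 mulr1 subrr normr0.
Qed.

(** Here [a] is at least [1 / alpha], [m'] is the actual number of parts and [x = K q <= n]. After
    multiplication by [a], each term is at most a fraction of [n^2], thanks to [K = 30 a m],
    [q >= 1024 a^2] and [sqrt q >= 32 a]; the fractions add up to [15/30 + 8/32 + 8/1024 < 1]. *)
Lemma error_bound (R : realType) (n K q t a m m' alpha : R) :
  1 <= a -> 1 <= m -> 0 <= m' <= m -> K = 30 * a * m -> 1024 * a ^+ 2 <= q ->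
  0 <= t -> q = t ^+ 2 -> K * q <= n -> 1 <= alpha * a ->
  2 * n * (K + m' * q) + K * q ^+ 2 + 8 * K ^+ 2 * q * t + 6 * q * K ^+ 2
    + 4 * q ^+ 2 * (K + 2 * m' * K) <= alpha * n ^+ 2.
Proof.
move=> a1 m1 /andP[m'0 m'm] KE aq t0 qt Kqn aalpha.
have a0 : 0 < a by lra.
have at_ : 32 * a <= t.
  by rewrite -ler_sqr ?nnegrE //; [rewrite exprMn -qt; lra | lra].
have qa : 1024 * a <= q by apply: le_trans aq; nra.
have q0 : 0 <= q by lra.
have K30 : 30 * a <= K by rewrite KE; nra.
have K0 : 0 <= K by lra.
set x := K * q in Kqn *; have x0 : 0 <= x by exact: mulr_ge0.
have n0 : 0 <= n by lra.
have xxn : x ^+ 2 <= n ^+ 2 by rewrite ler_sqr ?nnegrE.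
have xn : n * x <= n ^+ 2 by rewrite expr2 ler_wpM2l.
rewrite -(ler_pM2l a0).
have n2 : n ^+ 2 <= a * (alpha * n ^+ 2).
  by have := ler_wpM2r (sqr_ge0 n) aalpha; lra.
apply: le_trans n2.
have e1 : 1024 * (n * (a * K)) <= n * x.
  have := mulr_ge0 (mulr_ge0 n0 K0) (_ : 0 <= q - 1024 * a).
  by rewrite subr_ge0 => /(_ qa); rewrite /x; lra.
have e2 : 30 * (n * (a * m' * q)) <= n * x.
  have := mulr_ge0 (mulr_ge0 (mulr_ge0 n0 q0) (ltW a0)) (_ : 0 <= m - m').
  by rewrite subr_ge0 => /(_ m'm); rewrite /x KE; lra.
have e3 : 30 * (a * K * q ^+ 2) <= x ^+ 2.
  have := mulr_ge0 (mulr_ge0 K0 (sqr_ge0 q)) (_ : 0 <= K - 30 * a).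
  by rewrite subr_ge0 => /(_ K30); rewrite /x; lra.
have e4 : 32 * (a * K ^+ 2 * q * t) <= x ^+ 2.
  have := mulr_ge0 (mulr_ge0 (mulr_ge0 (sqr_ge0 K) q0) t0) (_ : 0 <= t - 32 * a).
  have -> : x ^+ 2 = K ^+ 2 * q * t ^+ 2 by rewrite -qt /x; ring.
  by rewrite subr_ge0 => /(_ at_); lra.
have e5 : 1024 * (a * q * K ^+ 2) <= x ^+ 2.
  have := mulr_ge0 (mulr_ge0 (sqr_ge0 K) q0) (_ : 0 <= q - 1024 * a).
  by rewrite subr_ge0 => /(_ qa); rewrite /x; lra.
have e6 : 30 * (a * q ^+ 2 * m' * K) <= x ^+ 2.
  have := mulr_ge0 (mulr_ge0 (mulr_ge0 (sqr_ge0 q) K0) (ltW a0)) (_ : 0 <= m - m').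
  have -> : x ^+ 2 = q ^+ 2 * K * (30 * a * m) by rewrite -KE /x; ring.
  by rewrite subr_ge0 => /(_ m'm); lra.
have := sqr_ge0 n; lra.
Qed.

(** With [K = 30 a m] pieces, the error bound needs [q >= 1024 a^2]. Graphs with fewer than
    [K * (1024 a^2)] vertices are split into singletons, which accounts for the size of the
    bound. *)
Lemma regular_bound_to_eq (R : realType) (eps alpha : R) (a m : nat) :
  0 <= eps -> 0 <= alpha -> (0 < a)%N -> 1 <= alpha * a%:R -> (0 < m)%N ->
  regular_bound eps m -> regular_bound_eq (eps + alpha) (30 * a * m * (1024 * a ^ 2)).
Proof.
move=> eps0 alpha0 a_gt0 aalpha m_gt0 reg T g sg.
set K := (30 * a * m)%N; set Q0 := (1024 * a ^ 2)%N.
have K_gt0 : (0 < K)%N by rewrite !muln_gt0 a_gt0.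
have Q0_gt0 : (0 < Q0)%N by rewrite muln_gt0 expn_gt0 a_gt0.
have [small|big] := ltnP #|T| (K * Q0).
  have [P [partP eqP leP irrP]] := singletons_regular R g.
  exists P; split=> //; first exact: leq_trans leP (ltnW small).
  by rewrite irrP mulr_ge0 ?addr_ge0 ?sqr_ge0.
set q := (#|T| %/ K)%N.
have q_ge : (Q0 <= q)%N by rewrite leq_divRL // mulnC.
have q_gt0 : (0 < q)%N by exact: leq_trans q_ge.
have nE : #|T| = (K * q + #|T| %% K)%N by rewrite {1}(divn_eq #|T| K) mulnC.
have [Q [partQ cardQ irrQ]] := reg T g sg.
have [P [partP eqP cardP irrP]] :=
  equitable_refinement R g partQ nE K_gt0 q_gt0 (ltnW (ltn_pmod _ K_gt0)).
exists P; split=> //; first by apply: leq_trans cardP _; rewrite leq_pmulr.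
apply: le_trans irrP _; rewrite [leRHS]mulrDl; apply: lerD => //.
apply: (@error_bound R _ _ _ _ a%:R m%:R) => //.
- by rewrite ler1n.
- by rewrite ler1n.
- by rewrite ler0n ler_nat.
- by rewrite !natrM.
- by rewrite -natrX -natrM ler_nat.
- by rewrite sqr_sqrtr.
- by rewrite -natrM ler_nat [leqRHS]nE leq_addr.
Qed.

(** A graph with one vertex already needs one part. *)
Lemma regular_bound_gt0 (R : realType) (eps : R) m : regular_bound eps m -> (0 < m)%N.
Proof.
move=> /(_ unit (fun _ _ => false)) [] // P [partP leP _].
apply: leq_trans leP; rewrite lt0n cards_eq0; apply/eqP => P0.
move: partP => /and3P[/eqP + _ _]; rewrite P0 /finset.cover big_set0 => /setP/(_ tt).
by rewrite !inE.
Qed.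

Theorem theorem2p2 (R : realType) :
  exists C : R, 0 < C /\
    forall eps alpha : R, 0 < eps < 1 -> 0 < alpha < 2^-1 ->
      (M_eq (eps + alpha) <= (C * alpha `^ (- C))%:E * M eps)%E.
Proof.
(* The factor [30 * 1024] comes from the number of parts and 8 from [a <= 2 / alpha], cubed. Keeping
   [C] abstract stops the numeral from being computed. *)
have [C CE] : exists C : R, C = 8 * 30 * 1024 by eexists.
have C3 : 3 <= C by rewrite CE; lra.
have C0 : 0 < C by lra.
exists C; split=> // eps alpha /andP[eps0 _] /andP[al0 al2].
have k_gt0 : 0 < C * alpha `^ (- C) by rewrite mulr_gt0 ?powR_gt0.
(* With the constant on the left, the infimum [M eps] is tested on each admissible [m]; the case of
   an infinite [M eps] needs no separate treatment. *)
rewrite -lee_pdivrMl //; apply: le_ereal_inf_tmp => _ [m reg <-].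
rewrite lee_pdivrMl //; have m_gt0 := regular_bound_gt0 reg.
pose a := (Num.truncn alpha^-1).+1.
have ial0 : 0 <= alpha^-1 by rewrite invr_ge0 ltW.
have /andP[a_lo a_hi] := truncn_itv ial0.
have aalpha : 1 <= alpha * a%:R by rewrite -ler_pdivrMl // mulr1 ltW.
have a_le : a%:R <= 2 * alpha^-1.
  have : 1 <= alpha^-1 by rewrite invf_ge1 //; lra.
  by rewrite /a -natr1; lra.
have regeq := regular_bound_to_eq (ltW eps0) (ltW al0) (ltn0Sn _) aalpha m_gt0 reg.
apply: le_trans (ereal_inf_lbound _) _.
  by exists (30 * a * m * (1024 * a ^ 2))%N; first exact: regeq.
rewrite -EFinM lee_fin !natrM.
(* As [alpha < 1] and [3 <= C], the cubic loss is absorbed by the exponent [C]. *)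
have pow3 : alpha^-1 ^+ 3 <= alpha `^ (- C).
  have -> : alpha^-1 ^+ 3 = alpha `^ (- 3%:R).
    by rewrite powRN powR_mulrn ?ltW // exprVn.
  by apply: ger_powR; [apply/andP; split; lra | rewrite lerN2].
have a3 : a%:R ^+ 3 <= 8 * alpha^-1 ^+ 3.
  have -> : 8 * alpha^-1 ^+ 3 = (2 * alpha^-1) ^+ 3 by ring.
  by rewrite lerXn2r // nnegrE // mulr_ge0.
have : C * (m%:R * alpha^-1 ^+ 3) <= C * (m%:R * alpha `^ (- C)).
  by apply: ler_wpM2l; [exact: ltW | exact: ler_wpM2l].
have : m%:R * a%:R ^+ 3 <= m%:R * (8 * alpha^-1 ^+ 3) by rewrite ler_wpM2l.
move: (alpha `^ _) => z; rewrite CE; lra.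
Qed.
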